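(* Let $\Gamma=(X,E)$ be $J(n,k)$ (with $2k\le n$), $J_q(n,k)$, or $H(n,2)$, with diameter $d$. For $j=0,\dots,d$ let $\mu_j=\sum_{i=0}^{d-j}a_{d-i}^{\,j}\,p_i(j)$. Then for every $f\in V_j$, $$\sum_{u\in\Omega_j}\langle \check u^j,f\rangle\,\check u^j=\mu_j f .$$ In particular, $\{\check u^j\}_{u\in\Omega_j}$ is a finite tight frame for $V_j$, i.e. $\sum_{u\in\Omega_j}\langle f,\check u^j\rangle^2=\mu_j\|f\|^2$ for all $f\in V_j$.
   Context: Graphs: (J) Johnson $J(n,k)$, $2k\le n$: vertices are the $k$-subsets of $[n]$, adjacent iff $|x\cap y|=k-1$; $d=k$. (G) Grassmann $J_q(n,k)$: $V$ an $n$-dimensional vector space over the field with $q$ elements, vertices the $k$-dimensional subspaces, adjacent iff $\dim(x\cap y)=k-1$; $d=k$. (H) Hypercube $H(n,2)$: vertices $\{1,-1\}^n$, adjacent iff they differ in exactly one coordinate; $d=n$. Lattice $\mathbf{L}=\bigcup_{\ell=0}^{d+1}\Omega_\ell$: (J) $\Omega_\ell$ = $\ell$-subsets of $[n]$ ($0\le\ell\le k$), $\Omega_{k+1}=\{\hat1\}$, $\hat1=[n]$, ordered by inclusion. (G) $\Omega_\ell$ = $\ell$-dimensional subspaces of $V$ ($0\le\ell\le k$), $\Omega_{k+1}=\{\hat1\}$, $\hat 1=V$, ordered by inclusion. (H) $\Omega_\ell$ ($0\le\ell\le n$) = pairs $(I_x,J_x)$ of disjoint subsets of $[n]$ with $|I_x\cup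 J_x|=\ell$, $\Omega_{n+1}=\{\hat1\}$, $x\le y$ iff $I_x\subseteq I_y$ and $J_x\subseteq J_y$, everything $\le\hat1$; $\Omega_n$ identified with $X$ (entry $1$ on $I_x$, $-1$ on $J_x$). In all cases $\Omega_d=X$. For $z\in\Omega_j$ and $0\le\ell\le d$: $a_j^\ell=|\{y\in\Omega_\ell:z\le y\}|$ if $j\le\ell$ and $a_j^\ell=|\{y\in\Omega_\ell:y\le z\}|$ if $j>\ell$ (independent of $z$). $\mathbb{R}^X$ has inner product $\langle f,g\rangle=\sum_x f(x)g(x)$, $\|f\|^2=\langle f,f\rangle$. $\iota_z(x)=1$ if $z\le x$, else $0$. $\Lambda_j=\mathrm{span}\{\iota_z:z\in\Omega_j\}$, $\Lambda_{-1}=\{0\}$, $V_j=\Lambda_j\cap\Lambda_{j-1}^\perp$; $\pi_j$ is the orthogonal projection onto $V_j$ and $\check u^j=\pi_j(\iota_u)$ for $u\in\Omega_j$. For $0\le i\le d$, $A_i$ is the $X\times X$ matrix with $(A_i)_{xy}=1$ if the graph distance of $x,y$ is $i$ and $0$ otherwise; each $A_i$ acts on $V_j$ as a scalar, denoted $p_i(j)$. *)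

(* Defs.v *)
From HB Require Import structures.
From mathcomp Require Import all_boot all_order all_algebra.
From mathcomp Require Import boolp classical_sets reals.

Set Implicit Arguments.
Unset Strict Implicit.
Unset Printing Implicit Defensive.

Import Order.TTheory GRing.Theory Num.Theory.
Local Open Scope ring_scope.

(* The subspaces of a vector space over a finite field form a finite type. *)
Import VectorInternalTheory.
HB.instance Definition _ (F : finFieldType) (vT : vectType F) :=
  [Countable of {vspace vT} by <:].
HB.instance Definition _ (F : finFieldType) (vT : vectType F) :=
  [Finite of {vspace vT} by <:].

(* A ranked lattice together with a graph on its elements of rank [depth];
   only the restriction of [adj] to those elements is used. *)
Record ranked_lattice := RankedLattice {
  elt : finType;
  lat_le : rel elt;
  level : nat -> {set elt};
  lat_top : elt;
  depth : nat;
  adj : rel elt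
}.

Definition Omega (L : ranked_lattice) (l : nat) : {set elt L} :=
  if (l <= depth L)%N then level L l
  else if l == (depth L).+1 then [set lat_top L] else finset.set0.

Definition vertex (L : ranked_lattice) : finType :=
  {x : elt L | x \in Omega L (depth L)}.

Definition johnson (n k : nat) : ranked_lattice := {|
  elt := {set 'I_n};
  lat_le := fun x y => x \subset y;
  level := fun l => [set x : {set 'I_n} | #|x| == l]%SET;
  lat_top := [set: 'I_n]%SET;
  depth := k;
  adj := fun x y => #|(x :&: y)%SET|.+1 == k
|}.

Definition grassmann (F : finFieldType) (V : vectType F) (k : nat) :
    ranked_lattice := {|
  elt := {vspace V};
  lat_le := fun x y => (x <= y)%VS;
  level := fun l => [set x : {vspace V} | \dim x == l]%SET;
  lat_top := fullv;
  depth := k;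
  adj := fun x y => (\dim (x :&: y)%VS).+1 == k
|}.

(* The entry at i of the partial sign vector encoded by the pair (I_x, J_x). *)
Definition entry (n : nat) (x : {set 'I_n} * {set 'I_n}) (i : 'I_n) : int :=
  if i \in x.1 then 1 else if i \in x.2 then -1 else 0.

(* The element ([n], [n]) lies above every pair and serves as the top. *)
Definition hypercube (n : nat) : ranked_lattice := {|
  elt := ({set 'I_n} * {set 'I_n})%type;
  lat_le := fun x y => (x.1 \subset y.1) && (x.2 \subset y.2);
  level := fun l => [set x : {set 'I_n} * {set 'I_n} |
                       [disjoint x.1 & x.2] && (#|(x.1 :|: x.2)%SET| == l)]%SET;
  lat_top := ([set: 'I_n]%SET, [set: 'I_n]%SET);
  depth := n;
  adj := fun x y => #|[set i | entry x i != entry y i]%SET| == 1%N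
|}.

(* In the Grassmann case the results hold for all k <= n, although k is the
   diameter of the graph only when 2k <= n. *)
Inductive classical_family : ranked_lattice -> Prop :=
  | JohnsonFamily (n k : nat) of (2 * k <= n)%N :
      classical_family (johnson n k)
  | GrassmannFamily (F : finFieldType) (V : vectType F) (k : nat)
      of (k <= \dim {:V})%N : classical_family (grassmann V k)
  | HypercubeFamily (n : nat) : classical_family (hypercube n).

(* a_j^l; the count does not depend on the chosen z of rank j. *)
Definition acount (L : ranked_lattice) (j l : nat) : nat :=
  if [pick z in Omega L j] is Some z then
    if (j <= l)%N then #|[set y in Omega L l | lat_le z y]%SET|
    else #|[set y in Omega L l | lat_le y z]%SET|
  else 0%N.

Definition walk (T : finType) (e : rel T) (i : nat) (x y : T) : bool :=
  [exists p : i.-tuple T, path e x p && (last x p == y)].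

Definition at_dist (T : finType) (e : rel T) (i : nat) (x y : T) : bool :=
  walk e i x y && [forall m : 'I_i, ~~ walk e m x y].

Definition dot (R : realType) (I : finType) (f g : {ffun I -> R^o}) : R :=
  \sum_x (f x : R) * g x.

Definition normsq (R : realType) (I : finType) (f : {ffun I -> R^o}) : R :=
  dot f f.

Definition orthov (R : realType) (I : finType) (U : {vspace {ffun I -> R^o}}) :
    {vspace {ffun I -> R^o}} :=
  lker (linfun (fun f => \row_(i < \dim U) dot (vbasis U)`_i f)).

Lemma dot_linear (R : realType) (I : finType) (g : {ffun I -> R^o}) :
  linear (dot g : {ffun I -> R^o} -> R^o).
Proof.
move=> a u v; rewrite /dot /GRing.scale /= mulr_sumr -big_split /=.
by apply: eq_bigr => x _; rewrite !ffunE /GRing.scale /= mulrDr mulrCA.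
Qed.

Lemma dotC (R : realType) (I : finType) (f g : {ffun I -> R^o}) :
  dot f g = dot g f.
Proof. by apply: eq_bigr => x _; rewrite mulrC. Qed.

Lemma dot_eq0 (R : realType) (I : finType) (f : {ffun I -> R^o}) :
  (dot f f == 0) = (f == 0).
Proof.
apply/eqP/eqP => [f0|->]; last first.
  by rewrite /dot big1 // => x _; rewrite ffunE mul0r.
apply/ffunP => x; rewrite ffunE; apply/eqP.
have /eqP := f0; rewrite /dot psumr_eq0; last first.
  by move=> y _; rewrite -expr2 sqr_ge0.
by move=> /allP/(_ x (mem_index_enum x)) /=; rewrite mulf_eq0 orbb.
Qed.

Lemma orthovP (R : realType) (I : finType) (U : {vspace {ffun I -> R^o}})
    (f : {ffun I -> R^o}) :
  reflect (forall g, g \in U -> dot g f = 0) (f \in orthov U).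
Proof.
pose F (h : {ffun I -> R^o}) := \row_(i < \dim U) dot (vbasis U)`_i h.
have linF : linear (F : _ -> 'rV[R^o]_(\dim U)).
  by move=> a u v; apply/rowP => i; rewrite !mxE dot_linear.
pose lF := GRing.isLinear.Build _ _ _ _ F linF.
pose FF : {linear {ffun I -> R^o} -> 'rV[R^o]_(\dim U)} := HB.pack F lF.
rewrite /orthov memv_ker (lfunE FF) /=; apply: (iffP eqP) => [F0 g gU|H].
  rewrite (coord_vbasis gU) dotC.
  have -> : dot f (\sum_i coord (vbasis U) i g *: (vbasis U)`_i) =
      \sum_i coord (vbasis U) i g * dot f (vbasis U)`_i.
    pose lD := GRing.isLinear.Build _ _ _ _ _ (@dot_linear R I f).
    pose D : {linear {ffun I -> R^o} -> R^o} := HB.pack (dot f : _ -> R^o) lD.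
    rewrite -[LHS]/(D _) linear_sum; apply: eq_bigr => i _.
    by rewrite linearZ.
  rewrite big1 // => i _; rewrite dotC.
  by move/rowP: F0 => /(_ i); rewrite !mxE => ->; rewrite mulr0.
apply/rowP => i; rewrite !mxE; apply: H; apply: vbasis_mem.
by rewrite mem_nth // size_tuple.
Qed.

Lemma orthov_cap (R : realType) (I : finType) (U : {vspace {ffun I -> R^o}}) :
  (U :&: orthov U = 0)%VS.
Proof.
apply/eqP; rewrite -subv0; apply/subvP => f.
by rewrite memv_cap memv0 => /andP[fU /orthovP/(_ f fU)/eqP]; rewrite dot_eq0.
Qed.

Lemma orthov_add (R : realType) (I : finType) (U : {vspace {ffun I -> R^o}}) :
  (U + orthov U = fullv)%VS.
Proof.
apply/eqP; rewrite -dimv_leqif_eq ?subvf //.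
rewrite eqn_leq dimvS ?subvf //= dimv_disjoint_sum ?orthov_cap //.
set F := linfun (fun f => \row_(i < \dim U) dot (vbasis U)`_i f).
have := limg_ker_dim F fullv; rewrite capfv => <-; rewrite addnC leq_add2r.
by rewrite (leq_trans (dimvS (subvf _))) // dimvf /dim /= mul1n.
Qed.

Definition orthproj (R : realType) (I : finType)
    (U : {vspace {ffun I -> R^o}}) : 'End({ffun I -> R^o}) :=
  daddv_pi U (orthov U).

Lemma orthprojP (R : realType) (I : finType) (U : {vspace {ffun I -> R^o}})
    (f : {ffun I -> R^o}) :
  orthproj U f \in U /\ f - orthproj U f \in orthov U.
Proof.
split; first exact: memv_pi.
have fUV : f \in (U + orthov U)%VS by rewrite orthov_add memvf.
rewrite -{1}(daddv_pi_add (orthov_cap U) fUV) addrC addKr.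
exact: memv_pi.
Qed.

Definition iota_fun (R : realType) (L : ranked_lattice) (z : elt L) :
    {ffun vertex L -> R^o} :=
  [ffun x => (lat_le z (val x))%:R].

Definition Lambda (R : realType) (L : ranked_lattice) (j : nat) :
    {vspace {ffun vertex L -> R^o}} :=
  (\sum_(z in Omega L j) <[iota_fun R z]>)%VS.

Definition Vspace (R : realType) (L : ranked_lattice) (j : nat) :
    {vspace {ffun vertex L -> R^o}} :=
  (Lambda R L j :&: orthov (if j is m.+1 then Lambda R L m else 0))%VS.

(* The vector u-check: the projection of iota_u onto V_j. *)
Definition ucheck (R : realType) (L : ranked_lattice) (j : nat) (u : elt L) :
    {ffun vertex L -> R^o} :=
  orthproj (Vspace R L j) (iota_fun R u).

Definition distmx (R : realType) (L : ranked_lattice) (i : nat)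
    (x y : vertex L) : R :=
  (at_dist (fun x y : vertex L => adj (val x) (val y)) i x y)%:R.

Definition distop (R : realType) (L : ranked_lattice) (i : nat)
    (f : {ffun vertex L -> R^o}) : {ffun vertex L -> R^o} :=
  [ffun x => \sum_y distmx R i x y * (f y : R)].

(* p_i(j), chosen among the scalars c such that A_i f = c f on V_j; c is unique
   when V_j != 0, and 0 is the default value when no such c exists. *)
Definition eigp (R : realType) (L : ranked_lattice) (i j : nat) : R :=
  xget 0 [set c : R | forall f, f \in Vspace R L j -> distop i f = c *: f]%classic.

(* Since j <= d - i in the sum, acount counts the elements of rank j below an
   element of rank d - i. *)
Definition mu (R : realType) (L : ranked_lattice) (j : nat) : R :=
  \sum_(0 <= i < (depth L - j).+1) (acount L (depth L - i) j)%:R * eigp R L i j.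

(* Frame bounds are positive; on the zero space every constant is a bound. *)
Definition tight_frame (R : realType) (I K : finType) (A : {set K})
    (v : K -> {ffun I -> R^o}) (U : {vspace {ffun I -> R^o}}) (c : R) : Prop :=
  [/\ forall u, u \in A -> v u \in U,
      U != 0%VS -> 0 < c
    & forall f, f \in U -> \sum_(u in A) dot f (v u) ^+ 2 = c * normsq f].

(* Main.v *)
(* On V_j the frame operator is the projection of f |-> sum_u <iota_u, f> iota_u,
   whose (x, y) entry is the number of u of rank j below x /\ y. This number
   depends only on the rank d - i of x /\ y, where i is the distance from x to y,
   so the operator is sum_i a_(d-i)^j A_i, which acts on V_j as mu_j.

   That A_i acts on V_j as a scalar follows from a group of automorphisms that is
   transitive on the pairs (z, x), z of rank j and x a vertex, with a given rank
   of z /\ x: hence A_i iota_z = b iota_z + (an element of Lambda_(j-1)) with b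
   independent of z. Since A_i is symmetric and preserves Lambda_(j-1), it also
   preserves the orthogonal complement, and A_i - b vanishes on V_j. *)
From HB Require Import structures.
Require Import Defs.
From mathcomp Require Import all_boot all_order all_algebra all_fingroup.
From mathcomp Require Import reals.
From mathcomp Require classical_sets.
From mathcomp Require Import zify.

Set Implicit Arguments.
Unset Strict Implicit.
Unset Printing Implicit Defensive.

Import Order.TTheory GRing.Theory Num.Theory.
Local Open Scope ring_scope.

(** The properties shared by the three families from which the theorem follows. [ranked_lattice]
    carries neither [meet] nor [grade], so both are parameters. [drl_aut] makes counts depend on
    ranks alone; [drl_adj], [drl_submod] and [drl_step] tie graph distance to the grade of the
    meet. *)
Record distance_regular_lattice (L : ranked_lattice)
    (meet : elt L -> elt L -> elt L) (grade : elt L -> nat) : Prop := {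
  drl_refl : reflexive (@lat_le L);
  drl_trans : transitive (@lat_le L);
  drl_anti : antisymmetric (@lat_le L);
  drl_meet : forall u x y, lat_le u (meet x y) = lat_le u x && lat_le u y;
  drl_grade : forall l z, z \in level L l -> grade z = l;
  drl_down : forall l x z, x \in level L l -> lat_le z x ->
    (grade z <= l)%N /\ z \in level L (grade z);
  drl_eq : forall l x z, x \in level L l -> z \in level L l ->
    lat_le z x -> z = x;
  drl_up : forall l z, z \in level L l -> (l < depth L)%N ->
    exists2 x, x \in level L l.+1 & lat_le z x;
  drl_between : forall l z x, z \in level L l -> x \in level L (depth L) ->
    (l < depth L)%N -> lat_le z x ->
    exists y, [/\ y \in level L l.+1, lat_le z y & lat_le y x];
  drl_aut : forall l z z' x x', (l <= depth L)%N ->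
    z \in level L l -> z' \in level L l ->
    x \in level L (depth L) -> x' \in level L (depth L) ->
    grade (meet z x) = grade (meet z' x') ->
    exists g : elt L -> elt L, [/\ {mono g : u v / lat_le u v},
      forall m u, (g u \in level L m) = (u \in level L m),
      g z = z' & g x = x'];
  drl_adj : forall x y, x \in level L (depth L) -> y \in level L (depth L) ->
    adj x y = ((grade (meet x y)).+1 == depth L);
  drl_submod : forall x a b, x \in level L (depth L) -> lat_le a x ->
    lat_le b x -> (grade a + grade b <= grade (meet a b) + depth L)%N;
  drl_step : forall x y, x \in level L (depth L) -> y \in level L (depth L) ->
    (grade (meet x y) < depth L)%N ->
    exists x', [/\ x' \in level L (depth L), adj x x' &
      grade (meet x' y) = (grade (meet x y)).+1]
}.

(** * Inner products and orthogonal projections *)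

Section Inner.
Variables (R : realType) (I : finType).
Implicit Types (f g : {ffun I -> R^o}) (U : {vspace {ffun I -> R^o}}).

Lemma dotDr f g h : dot f (g + h) = dot f g + dot f h.
Proof. by have := dot_linear f 1 g h; rewrite !scale1r. Qed.

Lemma dot0r f : dot f 0 = 0.
Proof. by rewrite /dot big1 // => x _; rewrite ffunE mulr0. Qed.

Lemma dotZr f a g : dot f (a *: g) = a * dot f g.
Proof. by have := dot_linear f a g 0; rewrite !addr0 dot0r addr0. Qed.

Lemma dotBr f g h : dot f (g - h) = dot f g - dot f h.
Proof. by rewrite dotDr -scaleN1r dotZr mulN1r. Qed.

Lemma dot_sumr (K : finType) (P : pred K) f (v : K -> {ffun I -> R^o}) :
  dot f (\sum_(u | P u) v u) = \sum_(u | P u) dot f (v u).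
Proof. by apply: (big_morph _ (dotDr f) (dot0r f)). Qed.

Lemma dot_ge0 f : 0 <= dot f f.
Proof. by apply: sumr_ge0 => x _; rewrite -expr2 sqr_ge0. Qed.

Lemma orthproj_id U f : f \in U -> orthproj U f = f.
Proof. exact: (daddv_pi_id (Defs.orthov_cap U)). Qed.

(** The residual of the projection is orthogonal to [f]. This lets [iota_fun R u] replace
    [ucheck R j u] in inner products with elements of V_j. *)
Lemma dot_orthproj U f g : f \in U -> dot (orthproj U g) f = dot g f.
Proof.
move=> fU; have [_ /Defs.orthovP/(_ f fU)] := orthprojP U g.
by rewrite dotBr ![dot f _]dotC => /eqP; rewrite subr_eq0 => /eqP.
Qed.

End Inner.

(** Forward substitution: the coefficient [b j.+1] can be chosen last, since [N j.+1 r] vanishes for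
    [r <= j] and so leaves the earlier equations intact. *)
Lemma unitriangular_expansion (R : realType) (N : nat -> nat -> R)
    (h : nat -> R) (j : nat) :
  (forall m, N m m = 1) -> (forall m r, (r < m)%N -> N m r = 0) ->
  exists b : nat -> R,
    forall r, (r <= j)%N -> h r = \sum_(m < j.+1) b m * N m r.
Proof.
move=> N1 N0; elim: j => [|j [b hb]].
  exists (fun=> h 0%N) => r; rewrite leqn0 => /eqP ->.
  by rewrite big_ord1 N1 mulr1.
(* The defect of the previous solution at [j.+1], where the diagonal entry is 1. *)
pose c := h j.+1 - \sum_(m < j.+1) b m * N m j.+1.
exists (fun m => if m == j.+1 then c else b m) => r.
rewrite big_ord_recr /= eqxx leq_eqVlt => /orP[/eqP ->|rj].
  rewrite N1 mulr1 addrC -[LHS](subrK (\sum_(m < j.+1) b m * N m j.+1)).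
  congr (_ + _); apply: eq_bigr => m _.
  by case: eqP (ltn_ord m) => // ->; rewrite ltnn.
rewrite N0 // mulr0 addr0 hb //; apply: eq_bigr => m _.
by case: eqP (ltn_ord m) => // ->; rewrite ltnn.
Qed.

(** * Ranks, meets and vertices in a distance-regular lattice *)

Section Regular.
Variables (R : realType) (L : ranked_lattice).
Variables (meet : elt L -> elt L -> elt L) (grade : elt L -> nat).
Hypothesis HL : distance_regular_lattice meet grade.

Notation d := (depth L).
Notation lev := (level L).
Notation le := (@lat_le L).

Lemma OmegaE l : (l <= d)%N -> Omega L l = lev l.
Proof. by rewrite /Omega => ->. Qed.

Lemma mem_Omega l z : (l <= d)%N -> (z \in Omega L l) = (z \in lev l).
Proof. by move=> ld; rewrite OmegaE. Qed.

Lemma vertexP (x : vertex L) : val x \in lev d.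
Proof. by rewrite -OmegaE //; apply: (valP x). Qed.

Lemma vertex_ex x : x \in lev d -> exists v : vertex L, val v = x.
Proof. by rewrite -OmegaE // => xO; exists (exist _ x xO). Qed.

Lemma meet_lel x y : le (meet x y) x.
Proof. by have := drl_refl HL (meet x y); rewrite (drl_meet HL) => /andP[]. Qed.

Lemma meet_ler x y : le (meet x y) y.
Proof. by have := drl_refl HL (meet x y); rewrite (drl_meet HL) => /andP[]. Qed.

Lemma meetC x y : meet x y = meet y x.
Proof.
by apply: (drl_anti HL); rewrite !(drl_meet HL) !meet_lel !meet_ler.
Qed.

Lemma meet_min w x : le w x -> meet w x = w.
Proof.
move=> wx; apply: (drl_anti HL).
by rewrite meet_lel (drl_meet HL) (drl_refl HL) wx.
Qed.

Lemma le_grade l a b : b \in lev l -> le a b -> (grade a <= grade b)%N.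
Proof. by move=> bl /(drl_down HL bl)[+ _]; rewrite (drl_grade HL bl). Qed.

Lemma le_grade_eq l a b :
  b \in lev l -> le a b -> grade a = grade b -> a = b.
Proof.
move=> bl ab; have [_ al] := drl_down HL bl ab.
rewrite (drl_grade HL bl) => e; rewrite e in al.
exact: (drl_eq HL bl al).
Qed.

Lemma exists_vertex_above l z : (l <= d)%N -> z \in lev l ->
  exists x : vertex L, le z (val x).
Proof.
move=> ld zl.
suff [x xl zx] : exists2 x, x \in lev d & le z x.
  by have [v ve] := vertex_ex xl; exists v; rewrite ve.
have [n dE] : exists n, d = (n + l)%N by exists (d - l)%N; rewrite subnK.
elim: n l z zl dE ld => [|n IH] l z zl dE ld.
  by exists z; [rewrite dE | apply: (drl_refl HL)].
have ld' : (l < d)%N by lia.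
have [y yl zy] := drl_up HL zl ld'.
have dE' : d = (n + l.+1)%N by lia.
have [x xl yx] := IH _ _ yl dE' ld'.
by exists x => //; apply: (drl_trans HL) zy yx.
Qed.

(** * Graph distance and the grade of the meet *)

Notation gm x y := (grade (meet (val x) (val y))).
Notation vadj := (fun x y : vertex L => adj (val x) (val y)).

Lemma vadjE (x y : vertex L) : adj (val x) (val y) = ((gm x y).+1 == d).
Proof. by rewrite (drl_adj HL) // vertexP. Qed.

Lemma gm_le_depth (x y : vertex L) : (gm x y <= d)%N.
Proof. by have [] := drl_down HL (vertexP x) (meet_lel (val x) (val y)). Qed.

Lemma gm_depth (x y : vertex L) : gm x y = d -> x = y.
Proof.
move=> e; apply: val_inj.
have gx := drl_grade HL (vertexP x); have gy := drl_grade HL (vertexP y).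
rewrite -(le_grade_eq (vertexP x) (meet_lel _ (val y))) ?gx //.
by rewrite {1}(le_grade_eq (vertexP y) (meet_ler (val x) _)) ?gy.
Qed.

Lemma gm_diag (x : vertex L) : gm x x = d.
Proof. by rewrite meet_min ?(drl_refl HL) // (drl_grade HL (vertexP x)). Qed.

(* x' /\ x and x' /\ y lie below x' and the first has corank 1, so they meet in
   corank at most 1 in x' /\ y. *)
Lemma gm_adj (x x' y : vertex L) :
  adj (val x) (val x') -> (gm x' y <= (gm x y).+1)%N.
Proof.
rewrite vadjE => /eqP e.
have xx' := meet_ler (val x) (val x'); have x'y := meet_lel (val x') (val y).
have := drl_submod HL (vertexP x') xx' x'y.
set m := meet (meet _ _) _.
have mx : (grade m <= gm x y)%N.
  have [_ xyl] := drl_down HL (vertexP x) (meet_lel (val x) (val y)).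
  apply: (le_grade xyl); rewrite (drl_meet HL).
  rewrite (drl_trans HL (meet_lel _ _) (meet_lel _ _)).
  by rewrite (drl_trans HL (meet_ler _ _) (meet_ler _ _)).
lia.
Qed.

(** By [gm_adj] each edge raises the grade of the meet with [y] by at most one, and at the end of
    the walk this grade is [d]. *)
Lemma walk_gm i (x y : vertex L) : walk vadj i x y -> (d <= gm x y + i)%N.
Proof.
case/existsP => p /andP[]; move: (size_tuple p).
elim: i x {p}(val p) => [|i IH] x [|x' p] //=.
  by move=> _ _ /eqP <-; rewrite gm_diag addn0.
case=> sp /andP[xx' pp] lp; apply: leq_trans (IH x' p sp pp lp) _.
by rewrite addnS -addSn leq_add2r; apply: gm_adj.
Qed.

Lemma gm_walk i (x y : vertex L) : (gm x y + i)%N = d -> walk vadj i x y.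
Proof.
elim: i x => [|i IH] x e.
  rewrite addn0 in e; rewrite (gm_depth e); apply/existsP; exists [tuple].
  by rewrite /= eqxx.
have lt : (gm x y < d)%N by lia.
have [x' [x'l xx' e']] := drl_step HL (vertexP x) (vertexP y) lt.
have [v ve] := vertex_ex x'l; rewrite -ve in xx' e'.
have /IH/existsP[p /andP[pp lp]] : (gm v y + i)%N = d by lia.
by apply/existsP; exists [tuple of v :: p]; rewrite /= xx' pp.
Qed.

Lemma at_distE i (x y : vertex L) :
  at_dist vadj i x y = ((gm x y + i)%N == d).
Proof.
apply/andP/eqP => [[wi /forallP nw]|e].
  have := walk_gm wi; rewrite leq_eqVlt => /orP[/eqP <- //|lt].
  have le_d := gm_le_depth x y.
  have mi : (d - gm x y < i)%N by lia.
  (* [gm_walk] gives a walk of length [d - gm x y], shorter than [i], against the minimality in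
     [at_dist]. *)
  by have /negP[] := nw (Ordinal mi); apply: gm_walk; rewrite subnKC.
split; first exact: gm_walk.
by apply/forallP => m; apply/negP => /walk_gm; have := ltn_ord m; lia.
Qed.

(** * Automorphisms and rank counts *)

Lemma aut_inj (g : elt L -> elt L) : {mono g : u v / le u v} -> injective g.
Proof.
move=> gle u v e; apply: (drl_anti HL).
by apply/andP; split; rewrite -gle e (drl_refl HL).
Qed.

Lemma aut_surj (g : elt L -> elt L) : injective g ->
  forall u, exists u', g u' = u.
Proof. by move=> gi u; exists (invF gi u); rewrite f_invF. Qed.

Lemma aut_meet (g : elt L -> elt L) : injective g -> {mono g : u v / le u v} ->
  forall x y, meet (g x) (g y) = g (meet x y).
Proof.
move=> gi gle x y; apply: (drl_anti HL).
rewrite (drl_meet HL) !gle meet_lel meet_ler andbT.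
have [m mE] := aut_surj gi (meet (g x) (g y)); rewrite -mE gle (drl_meet HL).
by rewrite -(gle _ x) -(gle _ y) mE meet_lel meet_ler.
Qed.

Lemma aut_grade (g : elt L -> elt L) :
  (forall m u, (g u \in lev m) = (u \in lev m)) ->
  forall l u, u \in lev l -> grade (g u) = grade u.
Proof.
move=> gl l u ul; rewrite (drl_grade HL ul).
by apply: (drl_grade HL); rewrite gl.
Qed.

(** For [z] below [x] the meet is [z] itself, so the grade condition of [drl_aut] is automatic. *)
Lemma flag_aut l z z' (x x' : vertex L) : (l <= d)%N ->
  z \in lev l -> z' \in lev l -> le z (val x) -> le z' (val x') ->
  exists g : elt L -> elt L, [/\ {mono g : u v / le u v},
      forall m u, (g u \in lev m) = (u \in lev m),
      g z = z' & g (val x) = val x'].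
Proof.
move=> ld zl zl' zx zx'; apply: (drl_aut HL ld) => //; try exact: vertexP.
by rewrite !meet_min // (drl_grade HL zl) (drl_grade HL zl').
Qed.

Lemma card_aut (g : elt L -> elt L) (A B : {set elt L}) : injective g ->
  (forall u, (g u \in B) = (u \in A)) -> #|A| = #|B|.
Proof.
move=> gi AB; rewrite -(card_preimset B gi).
by apply: eq_card => u; rewrite inE AB.
Qed.

Lemma below_card_const m l z z' : (l <= d)%N -> z \in lev l -> z' \in lev l ->
  #|[set u in lev m | le u z]%SET| = #|[set u in lev m | le u z']%SET|.
Proof.
move=> ld zl zl'.
have [x zx] := exists_vertex_above ld zl.
have [x' zx'] := exists_vertex_above ld zl'.
have [g [gle gl gz _]] := flag_aut ld zl zl' zx zx'.
by apply: (card_aut (aut_inj gle)) => u; rewrite !inE gl -gz gle.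
Qed.

(* [acount L r m] counts the elements below only when [m < r]; the diagonal is
   set to 1 even if rank [r] is empty, to keep the matrix unitriangular. *)
Definition below (m r : nat) : nat :=
  if m == r then 1%N else if (m < r)%N then acount L r m else 0%N.

Lemma belowE m l z : (l <= d)%N -> z \in lev l ->
  #|[set u in lev m | le u z]%SET| = below m l.
Proof.
move=> ld zl; rewrite /below; case: eqP => [->|/eqP ml].
  have -> : [set u in lev l | le u z]%SET = [set z]%SET; last by rewrite cards1.
  apply/setP => u; rewrite !inE; apply/andP/eqP => [[ul uz]|-> //].
    exact: (drl_eq HL zl ul uz).
  by rewrite (drl_refl HL).
case: ltnP => [lt|ge].
  rewrite /acount; case: pickP => [z' zl'|/(_ z)]; last by rewrite OmegaE // zl.
  rewrite leqNgt lt /= (OmegaE (ltnW (leq_trans lt ld))).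
  by apply: (below_card_const _ ld) => //; rewrite -OmegaE.
apply/eqP; rewrite cards_eq0; apply/eqP/setP => u; rewrite !inE.
apply/negP => /andP[ul uz]; have [+ _] := drl_down HL zl uz.
rewrite (drl_grade HL ul); lia.
Qed.

(** Only [m = r] needs an argument: there [acount] counts elements above, while [below] is set to 1.
    A level is an antichain, so the count is 1 too. *)
Lemma acount_below m r z : (m <= r <= d)%N -> z \in lev r ->
  acount L r m = below m r.
Proof.
case/andP; rewrite leq_eqVlt => /orP[/eqP -> {m} ld zl|mr ld zl]; last first.
  by rewrite /below mr ltn_eqF.
rewrite /acount; case: pickP => [z'|/(_ z)]; last by rewrite OmegaE // zl.
rewrite /= leqnn OmegaE // => zl'; rewrite /below eqxx.
have -> : [set u in lev r | le z' u]%SET = [set z']%SET; last by rewrite cards1.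
apply/setP => u; rewrite !inE; apply/andP/eqP => [[ul uz]|-> //].
  by rewrite (drl_eq HL ul zl' uz).
by rewrite (drl_refl HL).
Qed.

Lemma gm_level l z (x : vertex L) : z \in lev l ->
  (grade (meet z (val x)) <= l)%N /\
  meet z (val x) \in lev (grade (meet z (val x))).
Proof. by move=> zl; apply: (drl_down HL zl); apply: meet_lel. Qed.

(** * Distance operators and the filtration by the spaces Lambda_j *)

Local Notation iota := (iota_fun R).
Local Notation space := {ffun vertex L -> R^o}.

Lemma distop_lin i : linear (distop i : space -> space).
Proof.
move=> a f g; apply/ffunP => x; rewrite !ffunE /GRing.scale /= mulr_sumr.
rewrite -big_split /=; apply: eq_bigr => y _.
by rewrite !ffunE /GRing.scale /= mulrDr mulrCA.
Qed.

Lemma distmxE i (x y : vertex L) : distmx R i x y = ((gm x y + i)%N == d)%:R.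
Proof. by rewrite /distmx at_distE. Qed.

Lemma distop_sym i (f g : space) : dot (distop i f) g = dot f (distop i g).
Proof.
rewrite /dot.
under eq_bigr => x _ do rewrite ffunE mulr_suml.
under [RHS]eq_bigr => x _ do rewrite ffunE mulr_sumr.
rewrite exchange_big /=; apply: eq_bigr => y _; apply: eq_bigr => x _.
by rewrite !distmxE meetC -mulrA mulrCA.
Qed.

Lemma distop_iota_const i l z z' (x x' : vertex L) : (l <= d)%N ->
  z \in lev l -> z' \in lev l ->
  grade (meet z (val x)) = grade (meet z' (val x')) ->
  distop i (iota z) x = distop i (iota z') x'.
Proof.
move=> ld zl zl' e.
have [g [gle gl gz gx]] := drl_aut HL ld zl zl' (vertexP x) (vertexP x') e.
have gi := aut_inj gle.
have gv (v : vertex L) : g (val v) \in Omega L d.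
  by rewrite [_ \in _]mem_Omega // gl vertexP.
(* The automorphism [g] restricted to vertices: an injection of a finite type, hence a valid
   reindexing of the sum, which preserves distances and [iota]. *)
pose h (v : vertex L) : vertex L := exist _ (g (val v)) (gv v).
have hi : injective h by move=> u v /(congr1 val)/gi/val_inj.
rewrite !ffunE [RHS](reindex_inj hi) /=; apply: eq_bigr => y _.
rewrite !distmxE !ffunE /= -gz -gx gle aut_meet //.
rewrite (aut_grade gl (l := gm x y)) //.
by case: (gm_level y (vertexP x)).
Qed.

(* The value at x of A_i iota_z depends only on the grade of z /\ x, so it is a
   combination of the numbers of elements of each rank m below z /\ x, i.e. of
   the sums of the iota_w with w <= z of rank m. *)
Lemma distop_iota i l : (l <= d)%N -> exists b : nat -> R,
  forall z, z \in lev l -> distop i (iota z) =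
    \sum_(m < l.+1) b m *: \sum_(w in [set u in lev m | le u z]%SET) iota w.
Proof.
move=> ld.
pose P r := [pred p : elt L * vertex L |
  (p.1 \in lev l) && (grade (meet p.1 (val p.2)) == r)].
(* The common value over all pairs whose meet has grade [r]; by [distop_iota_const] the picked pair
   does not matter. The value 0 is a default for grades that do not occur. *)
pose h r : R := if [pick p | P r p] is Some p
  then distop i (iota p.1) p.2 else 0.
have [b hb] : exists b : nat -> R, forall r, (r <= l)%N ->
    h r = \sum_(m < l.+1) b m * (below m r)%:R.
  apply: (@unitriangular_expansion _ (fun m r => (below m r)%:R)) => m.
    by rewrite /below eqxx.
  by move=> r mr; rewrite /below gtn_eqF // ltnNge ltnW.
exists b => z zl; apply/ffunP => x.
have [rl ml] := gm_level x zl.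
have -> : distop i (iota z) x = h (grade (meet z (val x))).
  rewrite /h; case: pickP => [[z' x'] /andP[/= zl' /eqP e]|/(_ (z, x))].
    exact: (distop_iota_const _ ld).
  by rewrite /= zl eqxx.
rewrite hb // sum_ffunE; apply: eq_bigr => m _; rewrite ffunE sum_ffunE.
rewrite -(belowE m (leq_trans rl ld) ml) -sum1_card natr_sum /GRing.scale /=.
congr (_ * _); under [RHS]eq_bigr => w _ do rewrite ffunE.
rewrite big_mkcond [RHS]big_mkcond; apply: eq_bigr => w _.
rewrite !inE (drl_meet HL).
by case: (w \in _) => //=; case: (le w z) => //=; case: (le w _).
Qed.

Lemma iota_Lambda l z : (l <= d)%N -> z \in lev l -> iota z \in Lambda R L l.
Proof.
move=> ld zl; rewrite /Lambda.
have zO : z \in Omega L l by rewrite OmegaE.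
have /subv_sumP/(_ z zO)/subvP := subvv (\sum_(z in Omega L l) <[iota z]>)%VS.
by apply; apply: memv_line.
Qed.

Lemma Lambda_sub l (U : {vspace space}) : (l <= d)%N ->
  (forall z, z \in lev l -> iota z \in U) -> (Lambda R L l <= U)%VS.
Proof.
move=> ld H; rewrite /Lambda; apply/subv_sumP => z zl.
by rewrite -memvE; apply: H; rewrite -OmegaE.
Qed.

(** For [w] of rank [m], the sum of [iota z] over [z >= w] of rank [m.+1] is a multiple of [iota w]:
    its value at a vertex above [w] is a constant by [flag_aut], and nonzero by [drl_between]. *)
Lemma LambdaS m : (m < d)%N -> (Lambda R L m <= Lambda R L m.+1)%VS.
Proof.
move=> md; apply: Lambda_sub (ltnW md) _ => w wm.
have [x wx] := exists_vertex_above (ltnW md) wm.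
pose c (y : vertex L) := #|[set z in lev m.+1 | le w z && le z (val y)]%SET|.
have cc y : le w (val y) -> c y = c x.
  move=> wy; have [g [gle gl gw gy]] := flag_aut (ltnW md) wm wm wy wx.
  have wE u : le w (g u) = le w u by rewrite -{1}gw gle.
  by apply: (card_aut (aut_inj gle)) => u; rewrite !inE gl wE -gy gle.
have c0 : (c x)%:R != 0 :> R.
  rewrite pnatr_eq0 cards_eq0.
  have [y [ym wy yx]] := drl_between HL wm (vertexP x) md wx.
  by apply/set0Pn; exists y; rewrite inE ym wy yx.
suff e : \sum_(z in [set z in lev m.+1 | le w z]%SET) iota z
    = (c x)%:R *: iota w.
  rewrite -[iota w](scalerK c0) -e memvZ // memv_suml // => z.
  by rewrite inE => /andP[zl _]; apply: iota_Lambda.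
apply/ffunP => y; rewrite sum_ffunE !ffunE /GRing.scale /=.
under eq_bigr => z _ do rewrite ffunE.
transitivity ((c y)%:R : R).
  rewrite /c -sum1_card natr_sum big_mkcond [RHS]big_mkcond.
  apply: eq_bigr => z _; rewrite !inE.
  by case: (z \in _) => //=; case: (le w z) => //=; case: (le z _).
case wy: (le w (val y)); first by rewrite mulr1 cc.
rewrite mulr0; apply/eqP; rewrite pnatr_eq0 cards_eq0.
apply/eqP/setP => z; rewrite !inE; apply/negP => /and3P[_ wz zy].
by rewrite (drl_trans HL wz zy) in wy.
Qed.

Lemma Lambda_mono m l : (m <= l <= d)%N -> (Lambda R L m <= Lambda R L l)%VS.
Proof.
case/andP; elim: l => [|l IH]; first by rewrite leqn0 => /eqP->.
rewrite leq_eqVlt => /orP[/eqP-> //|ml ld].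
by apply: subv_trans (IH ml (ltnW ld)) (LambdaS ld).
Qed.

(** Gives a name to the match inside [Vspace], with the convention that Lambda_(-1) is zero. *)
Definition prev_Lambda j : {vspace space} :=
  if j is m.+1 then Lambda R L m else 0%VS.

Lemma Lambda_sub_prev m j : (m < j <= d)%N -> (Lambda R L m <= prev_Lambda j)%VS.
Proof.
by case: j => // j /andP[mj jd]; rewrite Lambda_mono //= -ltnS mj ltnW.
Qed.

Lemma prev_Lambda_sub j : (j <= d)%N -> (prev_Lambda j <= Lambda R L j)%VS.
Proof. by case: j => [|j] jd; rewrite ?sub0v // LambdaS. Qed.

(* Only the term m = j of [distop_iota] leaves Lambda_(j-1), and it is a multiple
   of iota_z. *)
Lemma distop_Lambda i j : (j <= d)%N -> exists c : R,
  forall f, f \in Lambda R L j -> distop i f - c *: f \in prev_Lambda j.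
Proof.
move=> jd; have [b hb] := distop_iota i jd; exists (b j).
(* Packed as a linear map, so that the inclusion need only be checked on the generators [iota z]. *)
pose T (f : space) : space := distop i f - b j *: f.
have linT : linear T.
  move=> a f g; rewrite /T distop_lin scalerDr opprD addrACA scalerBr.
  by rewrite !scalerA [b j * a]mulrC.
pose lT := GRing.isLinear.Build _ _ _ _ T linT.
pose TT : {linear space -> space} := HB.pack T lT.
move=> f fL; rewrite -[_ - _]/(TT f) -lfunE.
suff /subvP : (linfun TT @: Lambda R L j <= prev_Lambda j)%VS.
  by apply; apply: memv_img.
rewrite limg_sum; apply/subv_sumP => z zO; rewrite OmegaE // in zO.
rewrite limg_line -memvE lfunE /= /T hb // big_ord_recr /=.
have -> : [set u in lev j | le u z]%SET = [set z]%SET.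
  apply/setP => u; rewrite !inE; apply/andP/eqP => [[ul uz]|-> //].
    exact: (drl_eq HL zO ul uz).
  by rewrite (drl_refl HL).
rewrite big_set1 addrK memv_suml // => m _; rewrite memvZ // memv_suml // => w.
rewrite inE => /andP[wm _].
have mj : (m < j <= d)%N by rewrite ltn_ord.
apply: (subvP (Lambda_sub_prev mj)); apply: iota_Lambda => //; lia.
Qed.

Lemma distop_stable i j f : (j <= d)%N ->
  f \in Lambda R L j -> distop i f \in Lambda R L j.
Proof.
move=> jd fL; have [c hc] := distop_Lambda i jd.
rewrite -[distop i f](subrK (c *: f)) memvD ?memvZ //.
exact: (subvP (prev_Lambda_sub jd)) (hc f fL).
Qed.

Lemma distop_stable_prev i j f : (j <= d)%N ->
  f \in prev_Lambda j -> distop i f \in prev_Lambda j.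
Proof.
case: j => [|j] jd; last exact/distop_stable/ltnW.
rewrite !memv0 => /eqP ->; apply/eqP/ffunP => x; rewrite !ffunE.
by rewrite big1 // => y _; rewrite ffunE mulr0.
Qed.

Lemma memVspace j f : (f \in Vspace R L j) =
  (f \in Lambda R L j) && (f \in Defs.orthov (prev_Lambda j)).
Proof. by rewrite /Vspace memv_cap. Qed.

(** The defect [distop i f - c *: f] lies in [prev_Lambda j]. It is also orthogonal to that space,
    because [distop i] is symmetric and stabilizes it; hence it is orthogonal to itself and
    vanishes. *)
Lemma distop_eigen i j : (j <= d)%N -> exists c : R,
  forall f, f \in Vspace R L j -> distop i f = c *: f.
Proof.
move=> jd; have [c hc] := distop_Lambda i jd; exists c => f.
rewrite memVspace => /andP[fL /Defs.orthovP fO].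
apply/eqP; rewrite -subr_eq0 -dot_eq0; apply/eqP.
have dP := hc f fL.
by rewrite dotBr dotZr fO // mulr0 subr0 dotC distop_sym dotC fO ?distop_stable_prev.
Qed.

Lemma eigpP i j f : (j <= d)%N -> f \in Vspace R L j ->
  distop i f = eigp R L i j *: f.
Proof.
by move=> jd; apply: (classical_sets.xgetPex 0 (distop_eigen i jd)).
Qed.

(** * The frame identity *)

Lemma sum_iota j f : (j <= d)%N -> f \in Vspace R L j ->
  \sum_(u in Omega L j) dot (iota u) f *: iota u = mu R L j *: f.
Proof.
move=> jd fV; rewrite /mu scaler_suml.
under [RHS]eq_bigr => i _ do rewrite -scalerA -(eigpP i jd fV).
apply/ffunP => x; rewrite !sum_ffunE.
under eq_bigr => u _ do rewrite !ffunE /GRing.scale /= /dot mulr_suml.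
under [RHS]eq_bigr => i _ do rewrite !ffunE /GRing.scale /= mulr_sumr.
rewrite exchange_big [RHS]exchange_big /=; apply: eq_bigr => y _.
have [_ ml] := gm_level y (vertexP x); have rd := gm_le_depth x y.
(* The coefficient of [f y] on the left counts the [u] of rank [j] below both [x] and [y], that is,
   below their meet. *)
transitivity ((below j (gm x y))%:R * f y).
  rewrite -(belowE j rd ml) -sum1_card natr_sum mulr_suml OmegaE //.
  rewrite big_mkcond [RHS]big_mkcond; apply: eq_bigr => u _.
  rewrite !inE !ffunE (drl_meet HL); case: (u \in _) => //=.
  by case: (le u (val x)); case: (le u (val y));
    rewrite ?mulr1 ?mulr0 ?mul0r ?mul1r.
under [RHS]eq_bigr => i _ do rewrite mulrA distmxE.
rewrite -mulr_suml; congr (_ * _).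
(* If the meet has grade less than [j], nothing of rank [j] lies below it, and the distance exceeds
   [d - j], outside the range of the sum in [mu]. *)
have [jr|rj] := leqP j (gm x y); last first.
  rewrite /below gtn_eqF // ltnNge (ltnW rj) /= big_nat big1 // => i ij.
  have /negPf -> : (gm x y + i != d)%N by move: (gm x y) ij rj rd jd => r; lia.
  by rewrite mulr0.
rewrite -(acount_below _ ml) ?jr //.
(* Otherwise exactly one index survives, the distance between [x] and [y]. *)
have im : (d - gm x y)%N \in index_iota 0 (d - j).+1.
  by rewrite mem_index_iota ltnS leq_sub2l.
rewrite (bigD1_seq _ im (iota_uniq _ _)) /=.
rewrite subnKC // eqxx mulr1 subKn // big1_seq ?addr0 // => i /andP[/= ne _].
have /negPf -> : (gm x y + i != d)%N.
  by apply: contraNneq ne => e; rewrite -{1}(addKn (gm x y) i) e.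
by rewrite mulr0.
Qed.

(** Projecting [sum_iota] onto V_j gives the operator identity, and pairing that with [f] gives the
    tight frame identity. Positivity of the bound is shown on one nonzero vector. *)
Lemma ucheck_frame j : (j <= d)%N ->
  (forall f, f \in Vspace R L j ->
     \sum_(u in Omega L j) dot (ucheck R j u) f *: ucheck R j u
     = mu R L j *: f) /\
  tight_frame (Omega L j) (ucheck R j) (Vspace R L j) (mu R L j).
Proof.
move=> jd.
have uf f u : f \in Vspace R L j -> dot (ucheck R j u) f = dot (iota u) f.
  exact: dot_orthproj.
have H f : f \in Vspace R L j ->
    \sum_(u in Omega L j) dot (ucheck R j u) f *: ucheck R j u = mu R L j *: f.
  move=> fV; rewrite -[f in RHS](orthproj_id fV) -linearZ /= -sum_iota //.
  rewrite linear_sum; apply: eq_bigr => u _.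
  by rewrite uf // linearZ.
have N f : f \in Vspace R L j ->
    \sum_(u in Omega L j) dot f (ucheck R j u) ^+ 2 = mu R L j * normsq f.
  move=> fV; rewrite /normsq -dotZr -H // dot_sumr; apply: eq_bigr => u _.
  by rewrite dotZr [dot (ucheck _ _ _) f]dotC expr2.
split=> //; split=> // [u _|V0].
  by case: (orthprojP (Vspace R L j) (iota u)).
have := memv_pick (Vspace R L j); set f := vpick _ => fV.
have f0 : 0 < normsq f by rewrite lt0r dot_ge0 dot_eq0 vpick0 V0.
rewrite -(pmulr_lgt0 _ f0) -N // lt0r sumr_ge0 ?andbT; last first.
  by move=> u _; rewrite sqr_ge0.
apply/eqP => /psumr_eq0P S0.
(* If all frame coefficients of [f] vanish, [f] is orthogonal to every [iota u], hence to Lambda_j.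
   As [f] lies in Lambda_j, it would be zero. *)
have fL : f \in Defs.orthov (Lambda R L j).
  have sub : (Lambda R L j <= Defs.orthov <[f]>)%VS.
    apply: Lambda_sub => // u ul; apply/Defs.orthovP => g /vlineP[a ->].
    rewrite dotC dotZr -uf // dotC; apply/eqP; rewrite mulf_eq0.
    rewrite -[X in _ || X]sqrf_eq0 S0 ?eqxx ?orbT ?OmegaE //.
    by move=> v _; rewrite sqr_ge0.
  apply/Defs.orthovP => g /(subvP sub)/Defs.orthovP/(_ f (memv_line f)).
  by rewrite dotC.
move: fV; rewrite memVspace => /andP[fV _].
have /Defs.orthovP/(_ f fV)/eqP := fL.
by rewrite gt_eqF.
Qed.

End Regular.

(** * The Johnson lattice *)

Section Subsets.
Variable T : finType.
Implicit Types A B : {set T}.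

Lemma ltn_card_ex A B : (#|A| < #|B|)%N -> exists2 a, a \in B & a \notin A.
Proof.
move=> lt; apply/subsetPn; apply/negP => /subset_leq_card.
by rewrite leqNgt lt.
Qed.

End Subsets.

Section Relabel.
Variable n : nat.
Implicit Types A B : {set 'I_n}.

(** Equal colour classes make the two lists of colours equal as multisets; a permutation of
    positions matching the lists is the required [s]. *)
Lemma equicolored_perm (C : eqType) (f f' : 'I_n -> C) :
  (forall c, #|[set i | f i == c]| = #|[set i | f' i == c]|) ->
  exists s : 'S_n, forall i, f' (s i) = f i.
Proof.
move=> cE.
have /tuple_permP[s sE] : perm_eq [seq f i | i <- enum 'I_n]
    [tuple f' i | i < n].
  have h (h : 'I_n -> C) c :
      count_mem c [seq h i | i <- enum 'I_n] = #|[set i | h i == c]|.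
    rewrite count_map enumT cardE /enum_mem size_filter.
    by apply: eq_count => i; rewrite !inE.
  apply/allP => c _; apply/eqP.
  exact: etrans (h f c) (etrans (cE c) (esym (h f' c))).
exists s => i; have := congr1 (fun t => nth (f i) t i) sE.
rewrite (nth_map i) ?size_enum_ord ?nth_ord_enum // => ->.
by rewrite (nth_map i) ?size_enum_ord ?nth_ord_enum // tnth_mktuple.
Qed.

(** Each point is coloured by its memberships in the two sets; the three cardinalities determine the
    sizes of all four colour classes. *)
Lemma set_pair_perm A A' B B' :
  #|A| = #|A'| -> #|B| = #|B'| -> #|A :&: B| = #|A' :&: B'| ->
  exists s : 'S_n, forall i,
    (s i \in A') = (i \in A) /\ (s i \in B') = (i \in B).
Proof.
move=> eA eB eI.
pose f (X Y : {set 'I_n}) i := (i \in X, i \in Y).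
suff [s sE] : exists s : 'S_n, forall i, f A' B' (s i) = f A B i.
  by exists s => i; case: (sE i).
apply: equicolored_perm => -[[] []].
- have E X Y : [set i | f X Y i == (true, true)] = X :&: Y.
    by apply/setP => i; rewrite !inE /f xpair_eqE !eqb_id.
  by rewrite !E.
- have E X Y : [set i | f X Y i == (true, false)] = X :\: Y.
    by apply/setP => i; rewrite !inE /f xpair_eqE eqb_id eqbF_neg andbC.
  by rewrite !E !cardsD eA eI.
- have E X Y : [set i | f X Y i == (false, true)] = Y :\: X.
    by apply/setP => i; rewrite !inE /f xpair_eqE eqb_id eqbF_neg.
  by rewrite !E !cardsD ![B :&: _]setIC ![B' :&: _]setIC eB eI.
- have E X Y : [set i | f X Y i == (false, false)] = ~: (X :|: Y).
    by apply/setP => i; rewrite !inE /f xpair_eqE !eqbF_neg negb_or.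
  have cC (X : {set 'I_n}) : #|~: X| = (n - #|X|)%N.
    by rewrite cardsCs setCK card_ord.
  by rewrite !E !cC !cardsU eA eB eI.
Qed.

Lemma preim_perm_sub (s : 'S_n) A B :
  (s @^-1: A \subset s @^-1: B) = (A \subset B).
Proof.
apply/idP/idP => [/subsetP AB|]; last exact: preimsetS.
apply/subsetP => i iA; have := AB (s^-1 i)%g; rewrite !inE permKV.
exact.
Qed.

End Relabel.

Lemma johnson_drl n k : (k <= n)%N ->
  distance_regular_lattice (L := johnson n k) (@setI _)
    (fun x : {set 'I_n} => #|x|).
Proof.
move=> kn; split => /=.
- by move=> x; apply: subxx.
- by move=> x y z; apply: subset_trans.
- by move=> x y /andP[xy yx]; apply/eqP; rewrite eqEsubset xy.
- by move=> u x y; rewrite subsetI.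
- by move=> l z; rewrite inE => /eqP.
- by move=> l x z; rewrite !inE => /eqP <- /subset_leq_card.
- move=> l x z; rewrite !inE => /eqP xl /eqP zl zx.
  by apply/eqP; rewrite eqEcard zx xl zl /=.
- move=> l z; rewrite inE => /eqP zl lk.
  have [|a _ az] := @ltn_card_ex _ z setT.
    by rewrite cardsT card_ord zl (leq_trans lk).
  exists (a |: z); last exact: subsetUr.
  by rewrite inE cardsU1 az zl.
- move=> l z x; rewrite !inE => /eqP zl /eqP xl lk zx.
  have [|a ax az] := @ltn_card_ex _ z x; first by rewrite zl xl.
  exists (a |: z); split; last by rewrite subUset sub1set ax.
    by rewrite inE cardsU1 az zl.
  exact: subsetUr.
- move=> l z z' x x' lk; rewrite !inE => /eqP zl /eqP zl' /eqP xk /eqP xk' e.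
  (* The primed sets come first because the automorphism acts by preimage: [s @^-1: z] must be
     [z']. *)
  have [|||s sE] := @set_pair_perm _ z' z x' x; rewrite ?zl ?xk //.
  exists (fun u : {set 'I_n} => s @^-1: u); split.
  + by move=> u v; rewrite preim_perm_sub.
  + by move=> m u; rewrite !inE card_preimset //; apply: perm_inj.
  + by apply/setP => i; rewrite inE; case: (sE i).
  + by apply/setP => i; rewrite inE; case: (sE i).
- by [].
- move=> x a b; rewrite inE => /eqP <- ax bx.
  rewrite -cardsUI addnC leq_add2l; apply: subset_leq_card.
  by rewrite subUset ax.
- move=> x y; rewrite !inE => /eqP xk /eqP yk lt.
  have [|a ay] := @ltn_card_ex _ (x :&: y) y; first by rewrite yk.
  rewrite inE ay andbT => ax.
  have [|b bx] := @ltn_card_ex _ (x :&: y) x; first by rewrite xk.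
  rewrite inE bx /= => yb.
  (* Exchange a point [b] of [x] outside [y] for a point [a] of [y] outside [x]. *)
  exists (a |: (x :\ b)); split.
  + by rewrite inE cardsU1 !inE (negPf ax) andbF add1n -xk (cardsD1 b x) bx.
  + have -> : x :&: (a |: x :\ b) = x :\ b.
      apply/setP => i; rewrite !inE; case: (i =P a) => [->|_] /=.
        by rewrite (negPf ax) andbF.
      by case: (i \in x); rewrite ?andbF.
    by rewrite -xk (cardsD1 b x) bx.
  + have -> : (a |: x :\ b) :&: y = a |: (x :&: y).
      apply/setP => i; rewrite !inE; case: (i =P a) => [->|_] //=.
      by case: (i =P b) => [->|_] //=; rewrite (negPf yb) andbF.
    by rewrite cardsU1 !inE (negPf ax).
Qed.

(** * The Grassmann lattice *)

Section Grassmann.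
Variables (F : finFieldType) (V : vectType F).
Implicit Types A B C x z h : {vspace V}.

Lemma ltn_dim_ex A B : (\dim A < \dim B)%N -> exists2 v, v \in B & v \notin A.
Proof.
move=> lt; apply/subvPn; apply/negP => /dimvS.
by rewrite leqNgt lt.
Qed.

Lemma dim_addv_line A v : v \notin A -> \dim (A + <[v]>) = (\dim A).+1.
Proof.
move=> vA; rewrite dimv_disjoint_sum ?dim_vline.
  by case: eqP vA => [->|]; rewrite ?mem0v ?addn1.
apply/eqP; rewrite -subv0; apply/subvP => u; rewrite memv_cap => /andP[uA].
case/vlineP => a uE; move: uA; rewrite uE memv0 scaler_eq0.
by rewrite rpredZeq (negPf vA) orbF => ->.
Qed.

Lemma exists_dim_between A B m : (A <= B)%VS -> (\dim A <= m <= \dim B)%N ->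
  exists C, [/\ (A <= C)%VS, (C <= B)%VS & \dim C = m].
Proof.
move=> AB; elim: m => [|m IH] /andP[].
  by rewrite leqn0 => /eqP A0 _; exists A; rewrite A0 subvv.
rewrite leq_eqVlt => /orP[/eqP <- _|Am mB]; first by exists A; rewrite subvv.
have [|C [AC CB Cm]] := IH; first by rewrite -ltnS Am ltnW.
have [v vB vC] : exists2 v, v \in B & v \notin C.
  by apply: ltn_dim_ex; rewrite Cm.
exists (C + <[v]>)%VS; split.
- exact: subv_trans AC (addvSl _ _).
- by rewrite subv_add CB -memvE.
- by rewrite dim_addv_line // Cm.
Qed.

Lemma dim_cap_ge x A B : (A <= x)%VS -> (B <= x)%VS ->
  (\dim A + \dim B <= \dim (A :&: B) + \dim x)%N.
Proof.
move=> Ax Bx; rewrite -dimv_sum_cap addnC leq_add2l; apply: dimvS.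
by rewrite subv_add Ax.
Qed.

(** The map is defined through coordinates in [e]. Its image is spanned by [e'], hence is
    everything, and rank-nullity forces a zero kernel. *)
Lemma basis_lfun (e e' : seq V) : basis_of fullv e -> basis_of fullv e' ->
  size e = size e' ->
  exists f : 'End(V), lker f == 0%VS /\ [seq f v | v <- e] = e'.
Proof.
move=> be be' es; pose X := in_tuple e.
pose g v := \sum_(i < size e) coord X i v *: e'`_i.
have ling : linear g.
  move=> a u v; rewrite /g scaler_sumr -big_split /=; apply: eq_bigr => i _.
  by rewrite linearP scalerDl scalerA.
pose lg := GRing.isLinear.Build _ _ _ _ g ling.
pose gg : {linear V -> V} := HB.pack g lg.
have ge : [seq linfun gg v | v <- e] = e'.
  apply: (@eq_from_nth _ 0); rewrite size_map // => i ie.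
  rewrite (nth_map 0) // lfunE /= /g.
  have fX : free X := basis_free be.
  rewrite (bigD1 (Ordinal ie)) //= (coord_free (Ordinal ie) (Ordinal ie) fX).
  rewrite eqxx scale1r big1 ?addr0 // => j ji.
  by rewrite (coord_free (Ordinal ie) j fX) eq_sym (negPf ji) scale0r.
exists (linfun gg); split=> //.
have := limg_ker_dim (linfun gg) fullv.
rewrite -[X in \dim (_ @: X)%VS](span_basis be) limg_span ge (span_basis be').
by rewrite capfv => /eqP; rewrite -{2}[\dim fullv]add0n eqn_add2r dimv_eq0.
Qed.

(* b0 spans z :&: x, and b1, b2, b3 extend it to z, to x and to the whole space. *)
Lemma adapted_basis z x : exists b : seq V * seq V * seq V * seq V,
  let: (b0, b1, b2, b3) := b in
  [/\ basis_of fullv (b3 ++ (b1 ++ (b2 ++ b0))),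
      <<b1 ++ b0>>%VS = z, <<b2 ++ b0>>%VS = x,
      size b0 = \dim (z :&: x) &
      size b1 = (\dim z - \dim (z :&: x))%N /\
      size b2 = (\dim x - \dim (z :&: x))%N].
Proof.
exists (vbasis (z :&: x)%VS : seq V, vbasis (z :\: x)%VS : seq V,
  vbasis (x :\: z)%VS : seq V, vbasis (z + x)^C%VS : seq V).
have bx : basis_of x (vbasis (x :\: z)%VS ++ vbasis (z :&: x)%VS).
  rewrite -[x in basis_of x](addv_diff_cap x z) [(x :&: z)%VS]capvC.
  apply: cat_basis; try exact: vbasisP.
  apply/directv_addP/eqP; rewrite -subv0 -(capv_diff x z).
  by rewrite capvS ?capvSl.
split; rewrite ?size_tuple //.
- rewrite -(addv_complf (z + x)%VS) addvC; apply: cat_basis.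
  + by apply/directv_addP; rewrite capvC capv_compl.
  + exact: vbasisP.
  rewrite -addv_diff; apply: cat_basis => //; last exact: vbasisP.
  exact/directv_addP/capv_diff.
- by rewrite span_cat !(span_basis (vbasisP _)) addv_diff_cap.
- exact: span_basis bx.
- split.
    by rewrite -(dimv_cap_compl z x) addKn.
  by rewrite -(dimv_cap_compl x z) capvC addKn.
Qed.

(** The three dimensions fix the block sizes of the adapted bases, so the map between these bases
    sends block to block and thus [z] to [z'] and [x] to [x']. *)
Lemma vspace_pair_aut z z' x x' :
  \dim z = \dim z' -> \dim x = \dim x' -> \dim (z :&: x) = \dim (z' :&: x') ->
  exists f : 'End(V), [/\ lker f == 0%VS, (f @: z)%VS = z' & (f @: x)%VS = x'].
Proof.
move=> ez ex ei.
have [[[[b0 b1] b2] b3] [bb bz bx s0 [s1 s2]]] := adapted_basis z x.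
have [[[[c0 c1] c2] c3] [cb cz cx t0 [t1 t2]]] := adapted_basis z' x'.
have e0 : size b0 = size c0 by rewrite s0 t0.
have e1 : size b1 = size c1 by rewrite s1 t1 ez ei.
have e2 : size b2 = size c2 by rewrite s2 t2 ex ei.
have es : size (b3 ++ (b1 ++ (b2 ++ b0))) = size (c3 ++ (c1 ++ (c2 ++ c0))).
  have sb (e : seq V) : basis_of fullv e -> size e = \dim {:V}.
    by move=> be; rewrite (size_basis (X := in_tuple e) be).
  by rewrite (sb _ bb) (sb _ cb).
have e3 : size b3 = size c3.
  by move: es; rewrite !size_cat e0 e1 e2 => /eqP; rewrite eqn_add2r => /eqP.
have [f [f0 fE]] := basis_lfun bb cb es; exists f.
move/eqP: fE; rewrite !map_cat !eqseq_cat ?size_map //.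
case/and4P => /eqP f3 /eqP f1 /eqP f2 /eqP f00.
by rewrite -bz -bx !limg_span !map_cat f1 f2 f00 cz cx.
Qed.

Lemma grassmann_drl k : (k <= \dim {:V})%N ->
  distance_regular_lattice (L := grassmann V k)
    (fun x y : {vspace V} => (x :&: y)%VS) (fun x : {vspace V} => \dim x).
Proof.
move=> kn; split => /=.
- exact: subvv.
- by move=> x y z; apply: subv_trans.
- by move=> x y /andP[xy yx]; apply/eqP; rewrite eqEsubv xy.
- by move=> u x y; rewrite subv_cap.
- by move=> l z; rewrite inE => /eqP.
- by move=> l x z; rewrite !inE => /eqP <- /dimvS.
- move=> l x z; rewrite !inE => /eqP xl /eqP zl zx.
  by apply/eqP; rewrite eqEdim zx xl zl /=.
- move=> l z; rewrite inE => /eqP zl lk.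
  have [|y [zy _ yl]] := @exists_dim_between z fullv l.+1 (subvf z).
    by rewrite zl leqnSn (leq_trans lk).
  by exists y; rewrite // inE yl.
- move=> l z x; rewrite !inE => /eqP zl /eqP xl lk zx.
  have [|y [zy yx yl]] := @exists_dim_between z x l.+1 zx.
    by rewrite zl xl leqnSn lk.
  by exists y; rewrite inE yl.
- move=> l z z' x x' lk; rewrite !inE => /eqP zl /eqP zl' /eqP xk /eqP xk' e.
  have [||f [f0 fz fx]] := @vspace_pair_aut z z' x x' _ _ e; rewrite ?zl ?xk //.
  exists (fun u : {vspace V} => (f @: u)%VS); split=> //.
  + by move=> u v; rewrite limg_ker0.
  + by move=> m u; rewrite !inE limg_dim_eq // (eqP f0) capv0.
- by [].
- move=> x a b; rewrite inE => /eqP <-; exact: dim_cap_ge.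
- move=> x y; rewrite !inE => /eqP xk /eqP yk lt.
  have k0 : (0 < k)%N by apply: leq_ltn_trans lt.
  have [w wy] : exists2 w, w \in y & w \notin (x :&: y)%VS.
    by apply: ltn_dim_ex; rewrite yk.
  rewrite memv_cap wy andbT => wx.
  (* The neighbour of [x] will be [h + <[w]>], with [h] a hyperplane of [x] containing [x :&: y] and
     [w] in [y] but not in [x]. *)
  have [|h [xyh hx hk]] := @exists_dim_between (x :&: y)%VS x k.-1 (capvSl _ _).
    by rewrite xk leq_pred andbT -ltnS prednK.
  have wh : w \notin h by apply: contra wx; apply: (subvP hx).
  have x'k : \dim (h + <[w]>)%VS = k by rewrite dim_addv_line // hk prednK.
  exists (h + <[w]>)%VS; split; first by rewrite inE x'k.
    rewrite eqn_leq; apply/andP; split.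
      (* Equality of dimensions would give [x = h + <[w]>], putting [w] in [x]. *)
      rewrite ltnNge -xk; apply/negP => le.
      have xx' : (x :&: (h + <[w]>))%VS = x.
        by apply/eqP; rewrite eqEdim capvSl.
      have : (h + <[w]> <= x)%VS.
        have /eqP <- : x == (h + <[w]>)%VS.
          by rewrite eqEdim -{1}xx' capvSr xk x'k /=.
        exact: subvv.
      by rewrite subv_add -memvE (negPf wx) andbF.
    rewrite -{1}(prednK k0) ltnS -hk; apply: dimvS.
    by rewrite subv_cap hx addvSl.
  apply/eqP; rewrite eqn_leq; apply/andP; split.
    (* Upper bound: [h] has codimension 1 in the neighbour, so it cuts the neighbour's intersection
       with [y] by at most one dimension, and the result lies in [x :&: y]. *)
    have hx' : (h <= h + <[w]>)%VS by apply: addvSl.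
    have := dim_cap_ge (capvSl (h + <[w]>) y) hx'.
    have : (((h + <[w]>) :&: y) :&: h <= x :&: y)%VS.
      rewrite subv_cap (subv_trans (capvSr _ _) hx) /=.
      exact: subv_trans (capvSl _ _) (capvSr _ _).
    move/dimvS; rewrite x'k hk; move: (\dim _) (\dim _) (\dim _) => a b c.
    by move: k0; clear; lia.
  rewrite -(@dim_addv_line (x :&: y)%VS w); last by rewrite memv_cap negb_and wx.
  apply: dimvS; rewrite subv_cap !subv_add capvSr -!memvE wy andbT /=.
  by rewrite (subv_trans xyh) ?addvSl // memvE addvSr.
Qed.

End Grassmann.

(** * The hypercube lattice *)

Section Hypercube.
Variable n : nat.
Notation setpair := ({set 'I_n} * {set 'I_n})%type.
Implicit Types x y z u v : setpair.

Definition pmeet x y : setpair := (x.1 :&: y.1, x.2 :&: y.2).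
(** Equals the size of the support on disjoint pairs; as a sum it lets each component be treated
    separately. *)
Definition pgrade x : nat := (#|x.1| + #|x.2|)%N.

Lemma hypercube_levelP l x :
  reflect (x.1 :&: x.2 = set0 /\ pgrade x = l) (x \in level (hypercube n) l).
Proof.
rewrite inE -setI_eq0 /pgrade -cardsUI.
apply: (iffP andP) => [[/eqP dx /eqP e]|[dx]].
  by rewrite dx cards0 addn0.
by rewrite dx cards0 addn0 => ->; rewrite !eqxx.
Qed.

Lemma pgrade_le x y : lat_le (r := hypercube n) x y -> (pgrade x <= pgrade y)%N.
Proof. by case/andP => /subset_leq_card h1 /subset_leq_card; apply: leq_add. Qed.

Lemma vertex_setC x : x \in level (hypercube n) n -> x.2 = ~: x.1.
Proof.
case/hypercube_levelP => dx gx; apply/eqP; rewrite eqEcard.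
apply/andP; split; first by rewrite subsets_disjoint setCK -setI_eq0 setIC dx.
by rewrite cardsCs setCK card_ord -{1}gx addKn.
Qed.

Lemma setC_vertex (A : {set 'I_n}) : (A, ~: A) \in level (hypercube n) n.
Proof. by apply/hypercube_levelP; rewrite /pgrade /= setICr cardsC card_ord. Qed.

(** For vertices the grade of the meet is [n] minus the Hamming distance, which reduces adjacency
    and geodesic steps to counting coordinates. *)
Lemma pgrade_meet_vertex x y :
  x \in level (hypercube n) n -> y \in level (hypercube n) n ->
  pgrade (pmeet x y) = #|[set i | (i \in x.1) == (i \in y.1)]|.
Proof.
move=> /vertex_setC xC /vertex_setC yC; rewrite /pgrade /= xC yC -cardsUI.
have -> : (x.1 :&: y.1) :&: (~: x.1 :&: ~: y.1) = set0.
  by apply/setP => i; rewrite !inE; case: (i \in x.1) => //=; rewrite andbF.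
rewrite cards0 addn0; apply: eq_card => i; rewrite !inE.
by case: (i \in x.1); case: (i \in y.1).
Qed.

(** These are the signed permutations: coordinates are relabelled by [s], and signs are flipped on
    [D]. *)
Lemma signed_perm_aut (s : 'S_n) (D : pred 'I_n) :
  let g u : setpair := ([set i | if D i then s i \in u.2 else s i \in u.1],
                     [set i | if D i then s i \in u.1 else s i \in u.2]) in
  {mono g : u v / lat_le (r := hypercube n) u v} /\
  forall m u, (g u \in level (hypercube n) m) = (u \in level (hypercube n) m).
Proof.
move=> g; split=> [u v|m u].
  have leE a b : lat_le (r := hypercube n) a b =
      [forall i, ((i \in a.1) ==> (i \in b.1)) && ((i \in a.2) ==> (i \in b.2))].
    apply/andP/forallP => [[/subsetP h1 /subsetP h2] i|h].
      by apply/andP; split; apply/implyP; [apply: h1 | apply: h2].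
    by split; apply/subsetP => i; have /andP[/implyP h1 /implyP h2] := h i;
      [apply: h1 | apply: h2].
  rewrite !leE; apply/forallP/forallP => h i.
    have := h (s^-1 i)%g; rewrite !inE permKV.
    by case: (D _) => //; rewrite andbC.
  by have := h (s i); rewrite !inE; case: (D i) => //; rewrite andbC.
have eI : (g u).1 :&: (g u).2 = s @^-1: (u.1 :&: u.2).
  by apply/setP => i; rewrite !inE; case: (D i); rewrite // andbC.
have eU : (g u).1 :|: (g u).2 = s @^-1: (u.1 :|: u.2).
  by apply/setP => i; rewrite !inE; case: (D i); rewrite // orbC.
rewrite [LHS]inE [RHS]inE -!setI_eq0 eI eU -!cards_eq0.
by rewrite !card_preimset //; apply: perm_inj.
Qed.

Lemma hypercube_pair_aut l z z' x x' :
  z \in level (hypercube n) l -> z' \in level (hypercube n) l ->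
  x \in level (hypercube n) n -> x' \in level (hypercube n) n ->
  pgrade (pmeet z x) = pgrade (pmeet z' x') ->
  exists g : setpair -> setpair, [/\
    {mono g : u v / lat_le (r := hypercube n) u v},
    forall m u, (g u \in level (hypercube n) m) = (u \in level (hypercube n) m),
    g z = z' & g x = x'].
Proof.
move=> zl zl' xn xn' e.
(* An element z is determined by its support and the coordinates on which it
   agrees with the vertex x; this is how [set_pair_perm] applies to signs. *)
pose agree y v := (pmeet y v).1 :|: (pmeet y v).2.
pose supp y := y.1 :|: y.2.
have dI y m v : y \in level (hypercube n) m ->
    (y.1 :&: v.1) :&: (y.2 :&: v.2) = set0.
  case/hypercube_levelP => y0 _; apply/setP => i.
  have /setP/(_ i) := y0; rewrite !inE.
  by case: (i \in y.1) => //= ->; rewrite andbF.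
have cA y m v : y \in level (hypercube n) m ->
    #|agree y v| = pgrade (pmeet y v).
  by move=> yl; rewrite /pgrade -cardsUI (dI _ _ _ yl) cards0 addn0.
have cS y m : y \in level (hypercube n) m -> #|supp y| = m.
  by case/hypercube_levelP => y0 <-; rewrite /pgrade -cardsUI y0 cards0 addn0.
have sAS y v : agree y v :&: supp y = agree y v.
  by apply/setIidPl; rewrite setUSS // subsetIl.
have [|||s sE] := @set_pair_perm _ (agree z' x') (agree z x) (supp z') (supp z).
- by rewrite (cA _ _ _ zl) (cA _ _ _ zl').
- by rewrite (cS _ _ zl) (cS _ _ zl').
- by rewrite !sAS (cA _ _ _ zl) (cA _ _ _ zl').
(* Flip exactly where [x'] disagrees with the relabelled [x]. This sends [x] to [x'], and hence [z]
   to [z'], since [s] already matches supports and agreement sets. *)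
pose D i := (i \in x'.1) != (s i \in x.1).
have [gle gl] := signed_perm_aut s D.
eexists; split; [exact: gle | exact: gl | |].
  have z0 := proj1 (hypercube_levelP _ _ zl).
  have z0' := proj1 (hypercube_levelP _ _ zl').
  have h i : ((i \in z'.1), (i \in z'.2)) =
      if D i then (s i \in z.2, s i \in z.1) else (s i \in z.1, s i \in z.2).
    have [] := sE i; rewrite /D /agree /supp /pmeet /=.
    rewrite (vertex_setC xn) (vertex_setC xn') !inE.
    have /setP/(_ (s i)) := z0; have /setP/(_ i) := z0'; rewrite !inE.
    by case: (i \in z'.1); case: (i \in z'.2); case: (i \in x'.1);
      case: (s i \in x.1); case: (s i \in z.1); case: (s i \in z.2).
  rewrite [RHS]surjective_pairing; congr (_, _); apply/setP => i; rewrite inE;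
    by have := h i; case: (D i) => -[e1 e2]; rewrite ?e1 ?e2.
rewrite [RHS]surjective_pairing (vertex_setC xn) (vertex_setC xn').
congr (_, _); apply/setP => i; rewrite !inE /D;
  by case: (i \in x'.1); case: (s i \in x.1).
Qed.

Lemma hypercube_drl :
  distance_regular_lattice (L := hypercube n) pmeet pgrade.
Proof.
split.
- by move=> x; rewrite /= !subxx.
- move=> y x z /= /andP[h1 h2] /andP[k1 k2].
  by rewrite (subset_trans h1) // (subset_trans h2).
- move=> [x1 x2] [y1 y2] /= /andP[/andP[h1 h2] /andP[k1 k2]].
  by congr (_, _); apply/eqP; rewrite eqEsubset ?h1 ?h2.
- by move=> u x y; rewrite /= !subsetI andbACA.
- by move=> l z /hypercube_levelP[].
- move=> l x z /hypercube_levelP[dx <-] zx; split; first exact: pgrade_le.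
  apply/hypercube_levelP; split=> //; apply/eqP; rewrite -subset0 -dx.
  by case/andP: zx; apply: setISS.
- move=> l x z /hypercube_levelP[_ gx] /hypercube_levelP[_ gz] /andP[h1 h2].
  have := subset_leq_card h1; have := subset_leq_card h2.
  move: gz; rewrite -gx /pgrade => gz c2 c1.
  case: x z h1 h2 gz c1 c2 {gx} => [x1 x2] [z1 z2] /= h1 h2 gz c1 c2.
  by congr (_, _); apply/eqP; rewrite eqEcard ?h1 ?h2 /=; lia.
- move=> l z zl ln; have [dz gz] := hypercube_levelP _ _ zl.
  have [|a _] := @ltn_card_ex _ (z.1 :|: z.2) setT.
    by rewrite cardsT card_ord cardsU dz cards0 subn0 -[(_ + _)%N]/(pgrade z) gz.
  rewrite inE negb_or => /andP[a1 a2].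
  exists (a |: z.1, z.2); last by rewrite /= subsetUr subxx.
  apply/hypercube_levelP; rewrite /pgrade /= cardsU1 a1 add1n addSn.
  split; last by rewrite -gz.
  rewrite setIUl dz setU0; apply/setP => i; rewrite !inE.
  by case: eqP => // ->; rewrite (negPf a2).
- move=> l z x zl xn ln /andP[h1 h2].
  have [dz gz] := hypercube_levelP _ _ zl.
  have [dx gx] := hypercube_levelP _ _ xn.
  (* As [z] has smaller rank than [x], at least one of its two components can be enlarged within
     [x]. *)
  have [c1|c1] := ltnP #|z.1| #|x.1|.
    have [a ax az] := ltn_card_ex c1; exists (a |: z.1, z.2).
    have h1' : a |: z.1 \subset x.1 by rewrite subUset sub1set ax.
    split; rewrite /= ?h1' ?h2 ?subsetUr ?subxx //; apply/hypercube_levelP.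
    split; last by rewrite /pgrade /= cardsU1 az -gz.
    by apply/eqP; rewrite -subset0 -dx setISS.
  have [|a ax az] := @ltn_card_ex _ z.2 x.2.
    by move: gz gx ln c1; rewrite /pgrade /=; lia.
  exists (z.1, a |: z.2).
  have h2' : a |: z.2 \subset x.2 by rewrite subUset sub1set ax.
  split; rewrite /= ?h1 ?h2' ?subsetUr ?subxx //; apply/hypercube_levelP.
  split; last by rewrite /pgrade /= cardsU1 az add1n addnS -gz.
  by apply/eqP; rewrite -subset0 -dx setISS.
- move=> l z z' x x' _; exact: hypercube_pair_aut.
- move=> x y xn yn; rewrite pgrade_meet_vertex //=.
  have -> : [set i | entry x i != entry y i] =
      ~: [set i | (i \in x.1) == (i \in y.1)].
    apply/setP => i; rewrite !inE /entry (vertex_setC xn) (vertex_setC yn) !inE.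
    by case: (i \in x.1); case: (i \in y.1).
  (* The differing coordinates form the complement of the agreeing ones, so there is one of them
     exactly when [n - 1] agree. *)
  set A := [set i | _]; have := cardsC A; rewrite card_ord.
  by move: #|A| #|~: A| => a b ab; lia.
- move=> x a b xn /andP[a1 a2] /andP[b1 b2].
  have := proj2 (hypercube_levelP _ _ xn); rewrite /pgrade /= => gx.
  have c1 : (#|a.1 :|: b.1| <= #|x.1|)%N.
    by apply: subset_leq_card; rewrite subUset a1.
  have c2 : (#|a.2 :|: b.2| <= #|x.2|)%N.
    by apply: subset_leq_card; rewrite subUset a2.
  rewrite addnACA -(cardsUI a.1) -(cardsUI a.2) addnACA addnC.
  rewrite -[X in (_ <= _ + X)%N]gx leq_add2l.
  exact: leq_add.
- move=> x y xn yn; rewrite pgrade_meet_vertex // => lt.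
  have [|i _] := @ltn_card_ex _ [set i | (i \in x.1) == (i \in y.1)] setT.
    by rewrite cardsT card_ord.
  rewrite inE => xyi.
  (* The positive part of [x] after flipping coordinate [i], at which [x] and [y] differ. *)
  pose S := [set a | (a \in x.1) (+) (a == i)].
  have Sn := setC_vertex S.
  exists (S, ~: S); split=> //.
  + have -> : adj (r := hypercube n) x (S, ~: S) =
        (#|[set a | entry x a != entry (S, ~: S) a]| == 1%N) by [].
    have -> : [set a | entry x a != entry (S, ~: S) a] = [set i].
      apply/setP => a; rewrite !inE /entry (vertex_setC xn) !inE.
      by case: (a \in x.1); case: (a == i).
    by rewrite cards1.
  + rewrite !pgrade_meet_vertex //.
    set A := [set a | (a \in x.1) == _].
    have -> : [set a | (a \in (S, ~: S).1) == (a \in y.1)] = i |: A.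
      apply/setP => a; rewrite !inE; case: (a =P i) => [->|_].
        by move: xyi; case: (i \in x.1); case: (i \in y.1).
      by rewrite addbF.
    by rewrite cardsU1 inE xyi.
Qed.

End Hypercube.

(** * The frame theorem for the three families *)

Theorem theorem5p4 (R : realType) (L : ranked_lattice)
    (hL : classical_family L) (j : nat) (hj : (j <= depth L)%N) :
  (forall f, f \in Vspace R L j ->
     \sum_(u in Omega L j) dot (ucheck R j u) f *: ucheck R j u
     = mu R L j *: f) /\
  tight_frame (Omega L j) (ucheck R j) (Vspace R L j) (mu R L j).
Proof.
case: hL hj => [n k kn|F V k kn|n] hj.
- by apply: (ucheck_frame R (johnson_drl _) hj); lia.
- exact: (ucheck_frame R (grassmann_drl kn) hj).
- exact: (ucheck_frame R (hypercube_drl n) hj).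
Qed.
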